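(* Let $\mathcal W$ be a class of objects of $\mathcal C$ which is closed under finite direct sums and under hocokernels of $\xi$-inflations. Let $$Y_1\to Y_0\to Y\dashrightarrow\qquad (T)$$ be an $\mathbb E$-triangle in $\xi$, and let $$0\to Y_0\to W_0^0\to W_0^1\to\cdots\to W_0^i\to\cdots\qquad (R_0)$$ $$0\to Y_1\to W_1^0\to W_1^1\to\cdots\to W_1^i\to\cdots\qquad (R_1)$$ be coproper $\mathcal W(\xi)$-coresolutions of $Y_0$ and $Y_1$, respectively. (1) There are an object $W\in\mathcal W$, a coproper $\mathcal W(\xi)$-coresolution of $Y$ of the form $$0\to Y\to W\to W_0^1\oplus W_1^2\to\cdots\to W_0^i\oplus W_1^{i+1}\to\cdots\qquad (R)$$ and an $\mathbb E$-triangle $W_1^0\to W_0^0\oplus W_1^1\to W\dashrightarrow$ in $\xi$. (2) If, in addition, the $\xi$-exact complexes $(R_0)$, $(R_1)$ and the $\mathbb E$-triangle $(T)$ are $\mathcal C(\mathcal W,-)$-exact, then so is the complex $(R)$ obtained in (1) (that is, the data in (1) can be taken such that $(R)$ is moreover $\mathcal C(\mathcal W,-)$-exact).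
   Context: Extriangulated categories (Nakaoka–Palu). Let $\mathcal C$ be an additive category with an additive bifunctor $\mathbb E:\mathcal C^{\mathrm{op}}\times\mathcal C\to\mathrm{Ab}$. For $\delta\in\mathbb E(C,A)$, $a:A\to A'$, $c:C'\to C$ write $a_*\delta=\mathbb E(C,a)(\delta)$, $c^*\delta=\mathbb E(c,A)(\delta)$. For $\delta\in\mathbb E(C,A)$, $\delta'\in\mathbb E(C',A')$, a morphism $(a,c):\delta\to\delta'$ is a pair $a:A\to A'$, $c:C\to C'$ with $a_*\delta=c^*\delta'$. Two sequences $A\xrightarrow{x}B\xrightarrow{y}C$ and $A\xrightarrow{x'}B'\xrightarrow{y'}C$ are equivalent if there is an isomorphism $b:B\to B'$ with $bx=x'$, $y'b=y$. A realization $\mathfrak s$ assigns to each $\delta\in\mathbb E(C,A)$ an equivalence class $\mathfrak s(\delta)=[A\xrightarrow{x}B\xrightarrow{y}C]$ such that for every morphism $(a,c):\delta\to\delta'$ with $\mathfrak s(\delta)=[A\xrightarrow{x}B\xrightarrow{y}C]$, $\mathfrak s(\delta')=[A'\xrightarrow{x'}B'\xrightarrow{y'}C']$ there is $b:B\to B'$ with $bx=x'a$, $y'b=cy$. It is additive if $\mathfrak s(0)=[A\to A\oplus C\to C]$ (canonical maps) and $\mathfrak s(\delta\oplus\delta')=\mathfrak s(\delta)\oplus\mathfrak s(\delta')$. If $\mathfrak s(\delta)=[A\xrightarrow{x}B\xrightarrow{y}C]$, one calls $A\xrightarrow{x}B\xrightarrow{y}C\overset{\delta}{\dashrightarrow}$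 an $\mathbb E$-triangle, $x$ an inflation and $y$ a deflation. $(\mathcal C,\mathbb E,\mathfrak s)$ is extriangulated if $\mathfrak s$ is an additive realization and: (ET3) for $\mathbb E$-triangles $A\xrightarrow{x}B\xrightarrow{y}C\overset{\delta}{\dashrightarrow}$ and $A'\xrightarrow{x'}B'\xrightarrow{y'}C'\overset{\delta'}{\dashrightarrow}$ and morphisms $a:A\to A'$, $b:B\to B'$ with $bx=x'a$ there is $c:C\to C'$ with $cy=y'b$ and $a_*\delta=c^*\delta'$; (ET3)$^{\mathrm{op}}$ the dual; (ET4) for $\mathbb E$-triangles $A\xrightarrow{f}B\xrightarrow{f'}D\overset{\delta}{\dashrightarrow}$ and $B\xrightarrow{g}C\xrightarrow{g'}F\overset{\delta'}{\dashrightarrow}$ there are an $\mathbb E$-triangle $A\xrightarrow{gf}C\xrightarrow{h'}H\overset{\delta''}{\dashrightarrow}$ and morphisms $d:D\to H$, $e:H\to F$ with $h'g=df'$, $eh'=g'$, such that $D\xrightarrow{d}H\xrightarrow{e}F$ realizes $f'_*\delta'$, $d^*\delta''=\delta$ and $f_*\delta''=e^*\delta'$; (ET4)$^{\mathrm{op}}$ the dual. Proper classes. An $\mathbb E$-triangle is split if $\delta=0$. A class $\xi$ of $\mathbb E$-triangles closed under isomorphisms is a proper class if: (i) it is closed under finite coproducts and contains all split $\mathbb E$-triangles; (ii) it is closed under base change (if the $\mathbb E$-triangle realizing $\delta\in\mathbb E(C,A)$ is in $\xi$ and $c:C'\to C$, then any $\mathbb E$-triangle realizing $c^*\delta$ is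 in $\xi$) and cobase change (likewise for $a_*\delta$, $a:A\to A'$); (iii) it is saturated: if $A_1\to B_1\to C\overset{\delta_1}{\dashrightarrow}$ and $A_2\to B_2\xrightarrow{y_2}C\overset{\delta_2}{\dashrightarrow}$ are $\mathbb E$-triangles such that the second one and the $\mathbb E$-triangle $A_1\to M\to B_2\overset{y_2^*\delta_1}{\dashrightarrow}$ are in $\xi$, then the first one is in $\xi$. If $A\xrightarrow{x}B\xrightarrow{y}C\dashrightarrow$ is in $\xi$, then $x$ is a $\xi$-inflation, $y$ a $\xi$-deflation, $x$ is the hokernel of $y$ and $y$ the hocokernel of $x$. An object $P$ is $\xi$-projective if $0\to\mathcal C(P,A)\to\mathcal C(P,B)\to\mathcal C(P,C)\to0$ is exact for every $\mathbb E$-triangle $A\to B\to C\dashrightarrow$ in $\xi$; $\xi$-injective is dual. $\mathcal C$ has enough $\xi$-projectives (resp. $\xi$-injectives) if each object $A$ admits an $\mathbb E$-triangle $K\to P\to A\dashrightarrow$ (resp. $A\to I\to K\dashrightarrow$) in $\xi$ with $P$ $\xi$-projective (resp. $I$ $\xi$-injective). Standing assumptions. $(\mathcal C,\mathbb E,\mathfrak s)$ is an extriangulated category, $\xi$ is a proper class of $\mathbb E$-triangles, $\mathcal C$ has enough $\xi$-projectives and enough $\xi$-injectives, and Condition (WIC) holds: for composable $f,g$, if $gf$ is an inflation then so is $f$, and if $gf$ is a deflation then so is $g$. Exactness. For a class $\mathcal W$ of objects, an $\mathbb E$-triangle $A\to B\to C\dashrightarrow$ in $\xi$ is $\mathcal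 C(\mathcal W,-)$-exact (resp. $\mathcal C(-,\mathcal W)$-exact) if $0\to\mathcal C(W,A)\to\mathcal C(W,B)\to\mathcal C(W,C)\to0$ (resp. $0\to\mathcal C(C,W)\to\mathcal C(B,W)\to\mathcal C(A,W)\to0$) is exact for all $W\in\mathcal W$. Coresolutions. A $\mathcal W(\xi)$-coresolution of $A$ is a $\xi$-exact complex $0\to A\xrightarrow{d^0}W^0\xrightarrow{d^1}W^1\to\cdots$ with all $W^i\in\mathcal W$; $\xi$-exact means there are $\mathbb E$-triangles $K^i\xrightarrow{g^i}W^i\xrightarrow{f^i}K^{i+1}\dashrightarrow$ in $\xi$ ($i\ge0$) with $K^0=A$, $d^0=g^0$ and $d^{i}=g^{i}f^{i-1}$ for $i\ge1$. The complex is $\mathcal C(\mathcal W,-)$-exact (resp. $\mathcal C(-,\mathcal W)$-exact) if these $\mathbb E$-triangles can be chosen $\mathcal C(\mathcal W,-)$-exact (resp. $\mathcal C(-,\mathcal W)$-exact). A $\mathcal W(\xi)$-coresolution is coproper if it is $\mathcal C(-,\mathcal W)$-exact. $\mathcal W$ is closed under hocokernels of $\xi$-inflations if for each $\mathbb E$-triangle $A\to B\to C\dashrightarrow$ in $\xi$ with $A,B\in\mathcal W$ one has $C\in\mathcal W$. *)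

(* Defs.v *)
From mathcomp Require Import all_boot ssralg.

Set Implicit Arguments.
Unset Strict Implicit.
Unset Printing Implicit Defensive.

Import GRing.Theory.
Local Open Scope ring_scope.

Reserved Notation "g ∘ f" (at level 40, left associativity).
Reserved Notation "T ∈ xi" (at level 70, no associativity).
Reserved Notation "A ⊕ B" (at level 50, left associativity).

(* A zero object and binary biproducts are part of the structure. *)
Record additiveCategory := AdditiveCategory {
  obj :> Type;
  hom : obj -> obj -> zmodType;
  idm : forall A, hom A A;
  compm : forall A B D, hom B D -> hom A B -> hom A D;
  compmA : forall A B D F (h : hom D F) (g : hom B D) (f : hom A B),
    compm h (compm g f) = compm (compm h g) f;
  comp1m : forall A B (f : hom A B), compm (idm B) f = f;
  compm1 : forall A B (f : hom A B), compm f (idm A) = f;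
  compmDl : forall A B D (g g' : hom B D) (f : hom A B),
    compm (g + g') f = compm g f + compm g' f;
  compmDr : forall A B D (g : hom B D) (f f' : hom A B),
    compm g (f + f') = compm g f + compm g f';
  zob : obj;
  zob_final : forall A (f : hom A zob), f = 0;
  zob_initial : forall A (f : hom zob A), f = 0;
  dsum : obj -> obj -> obj;
  in1 : forall A B, hom A (dsum A B);
  in2 : forall A B, hom B (dsum A B);
  pr1 : forall A B, hom (dsum A B) A;
  pr2 : forall A B, hom (dsum A B) B;
  pr1_in1 : forall A B, compm (pr1 A B) (in1 A B) = idm A;
  pr2_in2 : forall A B, compm (pr2 A B) (in2 A B) = idm B;
  pr1_in2 : forall A B, compm (pr1 A B) (in2 A B) = 0;
  pr2_in1 : forall A B, compm (pr2 A B) (in1 A B) = 0;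
  in_pr : forall A B,
    compm (in1 A B) (pr1 A B) + compm (in2 A B) (pr2 A B) = idm (dsum A B)
}.

Arguments hom {a} A B.
Arguments idm {a} A.
Arguments compm {a A B D} g f.
Arguments zob {a}.
Arguments dsum {a} A B.
Arguments in1 {a} A B.
Arguments in2 {a} A B.
Arguments pr1 {a} A B.
Arguments pr2 {a} A B.

Notation "g ∘ f" := (compm g f) : ring_scope.
Notation "A ⊕ B" := (dsum A B) : ring_scope.

Section Morphisms.
Variable (C : additiveCategory).

Definition is_iso (A B : C) (f : hom A B) : Prop :=
  exists g : hom B A, g ∘ f = idm A /\ f ∘ g = idm B.

Definition msum (A B A' B' : C) (f : hom A B) (f' : hom A' B') :
    hom (A ⊕ A') (B ⊕ B') :=
  in1 B B' ∘ f ∘ pr1 A A' + in2 B B' ∘ f' ∘ pr2 A A'.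

Record sequence (A D : C) := Seq {
  seq_mid : C;
  seq_in : hom A seq_mid;
  seq_out : hom seq_mid D
}.

Definition seq_equiv (A D : C) (X Y : sequence A D) : Prop :=
  exists b : hom (seq_mid X) (seq_mid Y),
    [/\ is_iso b, b ∘ seq_in X = seq_in Y & seq_out Y ∘ b = seq_out X].

End Morphisms.

(* An additive bifunctor C^op x C -> Ab; [push E a] is a_* = E(D, a) and
   [pull E d] is d^* = E(d, A). *)
Record extBifunctor (C : additiveCategory) := ExtBifunctor {
  extE :> C -> C -> zmodType;
  push : forall (D A A' : C), hom A A' -> {additive extE D A -> extE D A'};
  pull : forall (D D' A : C), hom D' D -> {additive extE D A -> extE D' A};
  push1 : forall (D A : C) (e : extE D A), push D (idm A) e = e;
  push_comp : forall (D A A' A'' : C) (a' : hom A' A'') (a : hom A A')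
    (e : extE D A), push D (a' ∘ a) e = push D a' (push D a e);
  pushD : forall (D A A' : C) (a a' : hom A A') (e : extE D A),
    push D (a + a') e = push D a e + push D a' e;
  pull1 : forall (D A : C) (e : extE D A), pull A (idm D) e = e;
  pull_comp : forall (D D' D'' A : C) (d : hom D' D) (d' : hom D'' D')
    (e : extE D A), pull A (d ∘ d') e = pull A d' (pull A d e);
  pullD : forall (D D' A : C) (d d' : hom D' D) (e : extE D A),
    pull A (d + d') e = pull A d e + pull A d' e;
  push_pull : forall (D D' A A' : C) (a : hom A A') (d : hom D' D)
    (e : extE D A), push D' a (pull A d e) = pull A' d (push D a e)
}.

Arguments push {C} E {D A A'} a : rename.
Arguments pull {C} E {D D' A} d : rename.

(* The element of E(D (+) D', A (+) A') whose components in E(D, A), E(D, A'),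
   E(D', A), E(D', A') are e, 0, 0, e'. *)
Definition ext_sum (C : additiveCategory) (E : extBifunctor C) (A D A' D' : C)
    (e : E D A) (e' : E D' A') : E (D ⊕ D') (A ⊕ A') :=
  push E (in1 A A') (pull E (pr1 D D') e)
  + push E (in2 A A') (pull E (pr2 D D') e').

(* The equivalence class s(e) is represented by its membership predicate. *)
Record realization (C : additiveCategory) (E : extBifunctor C) := Realization {
  realizes : forall A D : C, E D A -> sequence A D -> Prop;
  realizes_class : forall (A D : C) (e : E D A),
    exists X, forall Y, realizes e Y <-> seq_equiv X Y;
  realizes_mor : forall (A D A' D' : C) (e : E D A) (e' : E D' A')
    (a : hom A A') (d : hom D D') (X : sequence A D) (X' : sequence A' D'),
    push E a e = pull E d e' -> realizes e X -> realizes e' X' ->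
    exists b : hom (seq_mid X) (seq_mid X'),
      b ∘ seq_in X = seq_in X' ∘ a /\ seq_out X' ∘ b = d ∘ seq_out X
}.

Section Extriangulated.
Variables (C : additiveCategory) (E : extBifunctor C) (s : realization E).

Definition additive_realization : Prop :=
  (forall A D : C, realizes s (0 : E D A) (Seq (in1 A D) (pr2 A D))) /\
  (forall (A B D A' B' D' : C) (x : hom A B) (y : hom B D) (e : E D A)
     (x' : hom A' B') (y' : hom B' D') (e' : E D' A'),
     realizes s e (Seq x y) -> realizes s e' (Seq x' y') ->
     realizes s (ext_sum e e') (Seq (msum x x') (msum y y'))).

Record etriangle (A B D : C) := ETriangle {
  infl : hom A B;
  defl : hom B D;
  ext : E D A;
  etriangleP : realizes s ext (Seq infl defl)
}.

Definition inflation (A B : C) (x : hom A B) : Prop :=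
  exists (D : C) (T : etriangle A B D), infl T = x.

Definition deflation (B D : C) (y : hom B D) : Prop :=
  exists (A : C) (T : etriangle A B D), defl T = y.

Definition ET3 : Prop :=
  forall (A B D A' B' D' : C) (T : etriangle A B D) (T' : etriangle A' B' D')
    (a : hom A A') (b : hom B B'),
    b ∘ infl T = infl T' ∘ a ->
    exists d : hom D D',
      d ∘ defl T = defl T' ∘ b /\ push E a (ext T) = pull E d (ext T').

Definition ET3op : Prop :=
  forall (A B D A' B' D' : C) (T : etriangle A B D) (T' : etriangle A' B' D')
    (b : hom B B') (d : hom D D'),
    d ∘ defl T = defl T' ∘ b ->
    exists a : hom A A',
      b ∘ infl T = infl T' ∘ a /\ push E a (ext T) = pull E d (ext T').

Definition ET4 : Prop :=
  forall (A B D G F : C) (T : etriangle A B D) (T' : etriangle B G F),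
  exists (H : C) (T'' : etriangle A G H) (d : hom D H) (e : hom H F),
    infl T'' = infl T' ∘ infl T /\
    defl T'' ∘ infl T' = d ∘ defl T /\
    e ∘ defl T'' = defl T' /\
    realizes s (push E (defl T) (ext T')) (Seq d e) /\
    pull E d (ext T'') = ext T /\
    push E (infl T) (ext T'') = pull E e (ext T').

Definition ET4op : Prop :=
  forall (A B D G F : C) (T : etriangle D B A) (T' : etriangle F G B),
  exists (H : C) (T'' : etriangle H G A) (d : hom H D) (e : hom F H),
    defl T'' = defl T ∘ defl T' /\
    defl T' ∘ infl T'' = infl T ∘ d /\
    infl T'' ∘ e = infl T' /\
    realizes s (pull E (infl T) (ext T')) (Seq e d) /\
    push E d (ext T'') = ext T /\
    pull E (defl T) (ext T'') = push E e (ext T').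

Record extriangulated : Prop := {
  extri_additive : additive_realization;
  extri_ET3 : ET3;
  extri_ET3op : ET3op;
  extri_ET4 : ET4;
  extri_ET4op : ET4op
}.

Definition WIC : Prop :=
  (forall (A B D : C) (f : hom A B) (g : hom B D),
     inflation (g ∘ f) -> inflation f) /\
  (forall (A B D : C) (f : hom A B) (g : hom B D),
     deflation (g ∘ f) -> deflation g).

Definition etriangle_iso (A B D A' B' D' : C) (T : etriangle A B D)
    (T' : etriangle A' B' D') : Prop :=
  exists (a : hom A A') (b : hom B B') (d : hom D D'),
    [/\ is_iso a, is_iso b & is_iso d] /\
    [/\ b ∘ infl T = infl T' ∘ a, d ∘ defl T = defl T' ∘ b
      & push E a (ext T) = pull E d (ext T')].

Definition etriangle_class : Type :=
  forall A B D : C, etriangle A B D -> Prop.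

Definition in_class (xi : etriangle_class) (A B D : C) (T : etriangle A B D) :
  Prop := @xi A B D T.

Notation "T ∈ xi" := (in_class xi T).

Record proper_class (xi : etriangle_class) : Prop := {
  proper_iso : forall (A B D A' B' D' : C) (T : etriangle A B D)
    (T' : etriangle A' B' D'), etriangle_iso T T' -> T ∈ xi -> T' ∈ xi;
  proper_sum : forall (A B D A' B' D' : C) (T : etriangle A B D)
    (T' : etriangle A' B' D') (S : etriangle (A ⊕ A') (B ⊕ B') (D ⊕ D')),
    infl S = msum (infl T) (infl T') -> defl S = msum (defl T) (defl T') ->
    ext S = ext_sum (ext T) (ext T') ->
    T ∈ xi -> T' ∈ xi -> S ∈ xi;
  proper_split : forall (A B D : C) (T : etriangle A B D),
    ext T = 0 -> T ∈ xi;
  proper_base : forall (A B D B' D' : C) (T : etriangle A B D) (d : hom D' D)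
    (T' : etriangle A B' D'),
    ext T' = pull E d (ext T) -> T ∈ xi -> T' ∈ xi;
  proper_cobase : forall (A B D A' B' : C) (T : etriangle A B D)
    (a : hom A A') (T' : etriangle A' B' D),
    ext T' = push E a (ext T) -> T ∈ xi -> T' ∈ xi;
  proper_saturated : forall (A1 B1 A2 B2 D M : C) (T1 : etriangle A1 B1 D)
    (T2 : etriangle A2 B2 D) (T : etriangle A1 M B2),
    ext T = pull E (defl T2) (ext T1) ->
    T2 ∈ xi -> T ∈ xi -> T1 ∈ xi
}.

Definition short_exact (U V Z : zmodType) (f : U -> V) (g : V -> Z) : Prop :=
  [/\ injective f,
      forall v, g v = 0 <-> exists u, f u = v
    & forall z, exists v, g v = z].

(* 0 -> C(X, A) -> C(X, B) -> C(X, D) -> 0 is exact *)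
Definition exact_from (X A B D : C) (T : etriangle A B D) : Prop :=
  short_exact (fun u : hom X A => infl T ∘ u) (fun v : hom X B => defl T ∘ v).

(* 0 -> C(D, X) -> C(B, X) -> C(A, X) -> 0 is exact *)
Definition exact_to (X A B D : C) (T : etriangle A B D) : Prop :=
  short_exact (fun u : hom D X => u ∘ defl T) (fun v : hom B X => v ∘ infl T).

(* C(W, -)-exactness and C(-, W)-exactness *)
Definition cov_exact (W : C -> Prop) : etriangle_class :=
  fun A B D T => forall X, W X -> exact_from X T.

Definition contra_exact (W : C -> Prop) : etriangle_class :=
  fun A B D T => forall X, W X -> exact_to X T.

Variable xi : etriangle_class.

Definition xi_projective (P : C) : Prop :=
  forall (A B D : C) (T : etriangle A B D), T ∈ xi -> exact_from P T.

Definition xi_injective (I : C) : Prop :=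
  forall (A B D : C) (T : etriangle A B D), T ∈ xi -> exact_to I T.

Definition enough_xi_projectives : Prop :=
  forall A : C, exists (K P : C) (T : etriangle K P A),
    T ∈ xi /\ xi_projective P.

Definition enough_xi_injectives : Prop :=
  forall A : C, exists (I K : C) (T : etriangle A I K),
    T ∈ xi /\ xi_injective I.

Definition closed_dsum (W : C -> Prop) : Prop :=
  W zob /\ forall A B : C, W A -> W B -> W (A ⊕ B).

Definition closed_hocokernel (W : C -> Prop) : Prop :=
  forall (A B D : C) (T : etriangle A B D), T ∈ xi -> W A -> W B -> W D.

(* A complex 0 -> A -> V 0 -> V 1 -> ...; [diff i] is the differential
   d^(i+1) : V i -> V (i+1), and [aug] is d^0. *)
Record cocomplex (A : C) (V : nat -> C) := Cocomplex {
  aug : hom A (V 0);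
  diff : forall i, hom (V i) (V i.+1);
  diff_aug : diff 0 ∘ aug = 0;
  diff_diff : forall i, diff i.+1 ∘ diff i = 0
}.

(* The objects K^0 = A and K^(i+1) = L i; with K^0 computing to A no equality
   between objects is needed. *)
Definition cosyzygy (A : C) (L : nat -> C) (i : nat) : C :=
  if i is j.+1 then L j else A.

Definition xi_exact_by (P : etriangle_class) (A : C) (V : nat -> C)
    (R : cocomplex A V) : Prop :=
  exists (L : nat -> C)
    (T : forall i, etriangle (cosyzygy A L i) (V i) (L i)),
    [/\ forall i, T i ∈ xi, forall i, T i ∈ P,
        aug R = infl (T 0)
      & forall i, diff R i = infl (T i.+1) ∘ defl (T i)].

Definition xi_exact (A : C) (V : nat -> C) (R : cocomplex A V) : Prop :=
  xi_exact_by (fun _ _ _ _ => True) R.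

Definition coresolution (W : C -> Prop) (A : C) (V : nat -> C)
    (R : cocomplex A V) : Prop :=
  xi_exact R /\ forall i, W (V i).

Definition coproper_coresolution (W : C -> Prop) (A : C) (V : nat -> C)
    (R : cocomplex A V) : Prop :=
  coresolution W R /\ xi_exact_by (contra_exact W) R.

(* The terms W, W_0^1 (+) W_1^2, ..., W_0^i (+) W_1^(i+1), ... *)
Definition cone_terms (W0 W1 : nat -> C) (W : C) (i : nat) : C :=
  if i is j.+1 then W0 j.+1 ⊕ W1 j.+2 else W.

End Extriangulated.

Notation "T ∈ xi" := (in_class xi T) : ring_scope.

(* Main.v *)
Require Import Defs.
From mathcomp Require Import all_boot ssralg.
From Stdlib Require Import ClassicalEpsilon.
Set Implicit Arguments.
Unset Strict Implicit.
Unset Printing Implicit Defensive.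
Import GRing.Theory.
Local Open Scope ring_scope.

(** The coresolution of [Y] is a mapping cone, built one triangle at a time.

    Glue [T] : Y1 -> Y0 -> Y and the first triangle Y1 -> W1^0 -> L1^0 of the
    coresolution of Y1 along Y1 ([bipushout]).  The common middle term M sits in
    two triangles of xi, W1^0 -> M -> Y and Y0 -> M -> L1^0, and the second one
    is C(-, WW)-exact because it is a cobase change of such a triangle.  The
    coresolutions of Y0 and of L1^0 (the tail of that of Y1) then combine by the
    horseshoe lemma ([horseshoe_coresolution]) into a coproper coresolution
    M -> W0^0 (+) W1^1 -> W0^1 (+) W1^2 -> ..., whose first cosyzygy is called
    L.  Finally (ET4) for W1^0 -> M -> W0^0 (+) W1^1 yields the triangle
    W1^0 -> W0^0 (+) W1^1 -> W, so W lies in WW, and a triangle Y -> W -> L,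
    again a cobase change; splicing it with the tail of the coresolution of M
    gives (R).

    One horseshoe step ([horseshoe]) for A -> B -> D is again a gluing followed
    by (ET4): gluing A -> B -> D with A -> WA -> A' gives WA -> M -> D and
    B -> M -> A'; the former splits since A -> WA extends to B, and the
    inflation B -> D (+) WA is composed with D (+) WA -> WA (+) WD.

    The new triangle of a composite is in xi because a triangle is in xi as soon
    as every morphism from a xi-projective to its third term lifts
    ([in_class_projective]).  C(X, -)-exactness survives gluing because the
    square B <- A -> G of a bipushout, completed by M, is also a weak pullback:
    A -> B (+) G -> M is a triangle ([pushout]).

    The two kinds of exactness are carried along together, for a class W of
    test objects on the contravariant side and an independent class V on the
    covariant side.  For the second part V is WW, but the triangles witnessing
    C(WW, -)-exactness of (R0) and (R1) need not be those witnessing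
    coproperness; [exact_from_decomposition] identifies the two families. *)

(** * Additive categories *)

Section Additive.
Variable C : additiveCategory.
Implicit Types A B D F X Z : C.

Lemma compm0 A B D (g : hom B D) : g ∘ (0 : hom A B) = 0.
Proof. by apply: (addrI (g ∘ (0 : hom A B))); rewrite -compmDr !addr0. Qed.

Lemma comp0m A B D (f : hom A B) : (0 : hom B D) ∘ f = 0.
Proof. by apply: (addrI ((0 : hom B D) ∘ f)); rewrite -compmDl !addr0. Qed.

Lemma compmN A B D (g : hom B D) (f : hom A B) : g ∘ (- f) = - (g ∘ f).
Proof. by apply: (addrI (g ∘ f)); rewrite -compmDr !subrr compm0. Qed.

Lemma compNm A B D (g : hom B D) (f : hom A B) : (- g) ∘ f = - (g ∘ f).
Proof. by apply: (addrI (g ∘ f)); rewrite -compmDl !subrr comp0m. Qed.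

Lemma pr1_in1K A B X (f : hom X A) : pr1 A B ∘ (in1 A B ∘ f) = f.
Proof. by rewrite compmA pr1_in1 comp1m. Qed.

Lemma pr2_in2K A B X (f : hom X B) : pr2 A B ∘ (in2 A B ∘ f) = f.
Proof. by rewrite compmA pr2_in2 comp1m. Qed.

Lemma pr1_in2K A B X (f : hom X B) : pr1 A B ∘ (in2 A B ∘ f) = 0.
Proof. by rewrite compmA pr1_in2 comp0m. Qed.

Lemma pr2_in1K A B X (f : hom X A) : pr2 A B ∘ (in1 A B ∘ f) = 0.
Proof. by rewrite compmA pr2_in1 comp0m. Qed.

Lemma dsum_ext A B X (f g : hom X (A ⊕ B)) :
  pr1 A B ∘ f = pr1 A B ∘ g -> pr2 A B ∘ f = pr2 A B ∘ g -> f = g.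
Proof.
move=> e1 e2; rewrite -(comp1m f) -(comp1m g) -in_pr !compmDl -!compmA.
by rewrite e1 e2.
Qed.

(** Meant to be used after [-!compmA]: the cancellation rules for structure
    maps of biproducts match composites nested to the right. *)
Definition biprodE := (compmDl, compmDr, compNm, compmN, compm0, comp0m,
  pr1_in1K, pr2_in2K, pr1_in2K, pr2_in1K, pr1_in1, pr2_in2, pr1_in2, pr2_in1,
  comp1m, compm1, addr0, add0r, oppr0).

Lemma is_iso_idm A : is_iso (idm A).
Proof. by exists (idm A); rewrite comp1m. Qed.

Definition swapm A B : hom (A ⊕ B) (B ⊕ A) :=
  in1 B A ∘ pr2 A B + in2 B A ∘ pr1 A B.

Lemma swapmK A B : swapm B A ∘ swapm A B = idm (A ⊕ B).
Proof.
rewrite /swapm -in_pr; apply: dsum_ext; rewrite !biprodE -!compmA !biprodE //.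
Qed.

Lemma is_iso_split A B (f : hom A B) (g g' : hom B A) :
  f ∘ g = idm B -> g' ∘ f = idm A -> is_iso f.
Proof.
move=> fg g'f; exists g; split => //.
have <- : g' = g by rewrite -(compm1 g') -fg compmA g'f comp1m.
exact: g'f.
Qed.

Lemma seq_equiv_trans A D (X Y Z : sequence A D) :
  seq_equiv X Y -> seq_equiv Y Z -> seq_equiv X Z.
Proof.
move=> [b [[b' [b'b bb']] bx yb]] [c [[c' [c'c cc']] cx yc]].
exists (c ∘ b); split.
- exists (b' ∘ c'); split.
  + by rewrite -compmA (compmA c') c'c comp1m.
  + by rewrite -compmA (compmA b) bb' comp1m.
- by rewrite -compmA bx.
- by rewrite compmA yc.
Qed.

Lemma seq_equiv_refl A D (X : sequence A D) : seq_equiv X X.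
Proof.
by exists (idm _); split; [exact: is_iso_idm | rewrite comp1m | rewrite compm1].
Qed.

Lemma seq_equiv_sym A D (X Y : sequence A D) : seq_equiv X Y -> seq_equiv Y X.
Proof.
move=> [b [[b' [b'b bb']] bx yb]]; exists b'; split.
- by exists b.
- by rewrite -bx compmA b'b comp1m.
- by rewrite -yb -compmA bb' compm1.
Qed.

Variable E : extBifunctor C.

Lemma pull0 D D' A (e : E D A) : pull E (0 : hom D' D) e = 0.
Proof. by apply: (addrI (pull E (0 : hom D' D) e)); rewrite -pullD !addr0. Qed.

Lemma pullB D D' A (d d' : hom D' D) (e : E D A) :
  pull E (d - d') e = pull E d e - pull E d' e.
Proof. by apply/eqP; rewrite eq_sym subr_eq -pullD subrK. Qed.

End Additive.

(** * Realizations and long exact sequences *)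

Section Extriangulated.
Variables (C : additiveCategory) (E : extBifunctor C) (s : realization E).
Hypothesis hs : extriangulated s.
Implicit Types A B D F X Z : C.

Lemma realizes_equiv A D (e : E D A) (X Y : sequence A D) :
  realizes s e X -> seq_equiv X Y -> realizes s e Y.
Proof.
have [Z Zs] := realizes_class s e => /Zs ZX XY; apply/Zs.
exact: seq_equiv_trans ZX XY.
Qed.

Lemma realizes_uniq A D (e : E D A) (X Y : sequence A D) :
  realizes s e X -> realizes s e Y -> seq_equiv X Y.
Proof.
have [Z Zs] := realizes_class s e => /Zs ZX /Zs ZY.
exact: seq_equiv_trans (seq_equiv_sym ZX) ZY.
Qed.

Lemma realizes_exists A D (e : E D A) :
  exists X : sequence A D, realizes s e X.
Proof.
by have [Z Zs] := realizes_class s e; exists Z; apply/Zs/seq_equiv_refl.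
Qed.

Definition splitT A D : etriangle s A (A ⊕ D) D :=
  ETriangle ((extri_additive hs).1 A D).

(** Compare with the split triangle on the same end terms. *)
Lemma defl_infl A B D (T : etriangle s A B D) : defl T ∘ infl T = 0.
Proof.
have [|b /= [bx yb]] := realizes_mor (a := idm A) (d := 0 : hom D D) _
  (etriangleP (splitT A D)) (etriangleP T).
  by rewrite raddf0 pull0.
by rewrite -(compm1 (infl T)) -bx compmA yb comp0m comp0m.
Qed.

(** The class pulls back along the deflation to the image of the class of
    the split triangle 0 -> B -> B. *)
Lemma pull_defl A B D (T : etriangle s A B D) : pull E (defl T) (ext T) = 0.
Proof.
have [|a [_ <-]] := extri_ET3op hs (T := splitT zob B) (T' := T)
  (b := pr2 zob B) (d := defl T); first by [].
by rewrite raddf0.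
Qed.

Lemma push_infl A B D (T : etriangle s A B D) : push E (infl T) (ext T) = 0.
Proof.
have [|d [_ ->]] := extri_ET3 hs (T := T) (T' := splitT B zob)
  (a := infl T) (b := in1 B zob); first by [].
by rewrite raddf0.
Qed.

(** Exactness of C(X,A) -> C(X,B) -> C(X,D) -> E(X,A) -> E(X,B) and of the
    first part of its dual; each statement compares the triangle with a split
    triangle having [X] as a direct summand. *)
Section LongExact.
Variables (A B D : C) (T : etriangle s A B D).

Lemma factor_infl X (p : hom X B) :
  defl T ∘ p = 0 -> exists t : hom X A, p = infl T ∘ t.
Proof.
move=> yp; have [|t [/= e _]] := extri_ET3op hs (T := splitT X zob) (T' := T)
  (b := p ∘ pr1 X zob) (d := 0).
  by rewrite comp0m compmA yp comp0m.
by exists t; rewrite -e -compmA pr1_in1 compm1.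
Qed.

Lemma factor_defl X (p : hom B X) :
  p ∘ infl T = 0 -> exists t : hom D X, p = t ∘ defl T.
Proof.
move=> px; have [|t [/= e _]] := extri_ET3 hs (T := T) (T' := splitT zob X)
  (b := in2 zob X ∘ p) (a := 0).
  by rewrite compm0 -compmA px compm0.
by exists t; rewrite e pr2_in2K.
Qed.

Lemma lift_defl X (t : hom X D) :
  pull E t (ext T) = 0 -> exists p : hom X B, t = defl T ∘ p.
Proof.
move=> t0; have [|b /= [_ yb]] := realizes_mor (a := idm A) (d := t) _
  (etriangleP (splitT A X)) (etriangleP T).
  by rewrite raddf0 t0.
by exists (b ∘ in2 A X); rewrite compmA yb -compmA pr2_in2 compm1.
Qed.

Lemma extend_infl X (u : hom A X) :
  push E u (ext T) = 0 -> exists p : hom B X, u = p ∘ infl T.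
Proof.
move=> u0; have [|b /= [bx _]] := realizes_mor (a := u) (d := idm D) _
  (etriangleP T) (etriangleP (splitT X D)).
  by rewrite raddf0 u0.
by exists (pr1 X D ∘ b); rewrite -compmA bx pr1_in1K.
Qed.


Lemma connecting_lift X (e : E X A) :
  push E (infl T) e = 0 -> exists t : hom X D, e = pull E t (ext T).
Proof.
move=> e0; have [[M x y] Me] := realizes_exists e.
pose U := ETriangle Me.
have [|b /= [bx _]] := realizes_mor (a := infl T) (d := idm X) _ Me
  (etriangleP (splitT B X)).
  by rewrite raddf0 e0.
have [|d [/= _ ed]] := extri_ET3 hs (T := U) (T' := T) (a := idm A)
  (b := pr1 B X ∘ b).
  by rewrite -compmA /= bx pr1_in1K compm1.
by exists d; rewrite -ed push1.
Qed.

End LongExact.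

(** * Isomorphisms of triangles *)

(** Both half sequences are needed: the four lemma for C(X, -) makes the middle
    map a split epimorphism, the one for C(-, X) a split monomorphism. *)
Lemma mid_iso A B D A' B' D' (T : etriangle s A B D)
    (T' : etriangle s A' B' D')
    (a : hom A A') (b : hom B B') (d : hom D D') :
  b ∘ infl T = infl T' ∘ a -> defl T' ∘ b = d ∘ defl T ->
  push E a (ext T) = pull E d (ext T') ->
  is_iso a -> is_iso d -> is_iso b.
Proof.
move=> bx yb e [a' [a'a aa']] [d' [d'd dd']].
have [r br] : exists r, b ∘ r = idm B'.
  have [|p yp] := lift_defl (T := T) (t := d' ∘ defl T').
    have -> : ext T = push E a' (pull E d (ext T')).
      by rewrite -e -push_comp a'a push1.
    rewrite push_pull -pull_comp compmA dd' comp1m -push_pull pull_defl.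
    by rewrite raddf0.
  have [|t pt] := factor_infl (T := T') (p := idm B' - b ∘ p).
    rewrite !biprodE compmA yb -compmA -yp compmA dd' comp1m.
    exact: subrr.
  exists (p + infl T ∘ a' ∘ t).
  rewrite compmDr !compmA bx -(compmA _ a) aa' compm1 -pt addrC.
  exact: subrK.
have [l lb] : exists l, l ∘ b = idm B.
  have [|p px] := extend_infl (T := T') (u := infl T ∘ a').
    have -> : ext T' = pull E d' (push E a (ext T)).
      by rewrite e -pull_comp dd' pull1.
    rewrite push_pull -push_comp -compmA a'a compm1 push_infl.
    by rewrite raddf0.
  have [|t pt] := factor_defl (T := T) (p := idm B - p ∘ b).
    rewrite !biprodE -compmA bx compmA -px -compmA a'a compm1.
    exact: subrr.
  exists (p + t ∘ d' ∘ defl T').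
  rewrite compmDl -!compmA yb (compmA d') d'd comp1m -pt addrC.
  exact: subrK.
exact: is_iso_split br lb.
Qed.

(** The five lemma for C(X, -): the sequence is exact for two more terms to the
    right of C(X, D), so that bijectivity can be tested on one side. *)
Lemma cone_iso A B D A' B' D' (T : etriangle s A B D)
    (T' : etriangle s A' B' D')
    (a : hom A A') (b : hom B B') (d : hom D D') :
  b ∘ infl T = infl T' ∘ a -> d ∘ defl T = defl T' ∘ b ->
  push E a (ext T) = pull E d (ext T') ->
  is_iso a -> is_iso b -> is_iso d.
Proof.
move=> bx yb e [a' [a'a aa']] [b' [b'b bb']].
have xb' : b' ∘ infl T' = infl T ∘ a'.
  rewrite -(compm1 (infl T')) -aa' (compmA _ a) -bx -compmA compmA b'b.
  exact: comp1m.
have dinj X (u : hom X D) : d ∘ u = 0 -> u = 0.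
  move=> du; have [|p up] := lift_defl (T := T) (t := u).
    have -> : ext T = push E a' (pull E d (ext T')).
      by rewrite -e -push_comp a'a push1.
    by rewrite -push_pull -pull_comp du pull0 raddf0.
  have [|t bpt] := factor_infl (T := T') (p := b ∘ p).
    by rewrite compmA -yb -compmA -up.
  have -> : u = defl T ∘ infl T ∘ (a' ∘ t).
    by rewrite up -(comp1m p) -b'b -(compmA b') bpt (compmA b') xb' !compmA.
  by rewrite defl_infl comp0m.
have [r dr] : exists r, d ∘ r = idm D'.
  have [|t et] := connecting_lift (T := T) (e := push E a' (ext T')).
    by rewrite -push_comp -xb' push_comp push_infl raddf0.
  have [|p yp] := lift_defl (T := T') (t := idm D' - d ∘ t).
    rewrite pullB pull_comp -e pull1 -push_pull -et -push_comp aa' push1.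
    exact: subrr.
  exists (t + defl T ∘ b' ∘ p).
  rewrite compmDr !compmA yb -(compmA _ b) bb' compm1 -yp addrC.
  exact: subrK.
exists r; split => //; apply/eqP; rewrite -subr_eq0; apply/eqP/dinj.
rewrite compmDr compmN compmA dr comp1m compm1; exact: subrr.
Qed.

Lemma transport_mid A B D B' (T : etriangle s A B D) (f : hom B B')
    (g : hom B' B) : g ∘ f = idm B -> f ∘ g = idm B' ->
  exists T' : etriangle s A B' D,
    [/\ infl T' = f ∘ infl T, defl T' = defl T ∘ g & ext T' = ext T].
Proof.
move=> gf fg.
have sT' : realizes s (ext T) (Seq (f ∘ infl T) (defl T ∘ g)).
  apply: realizes_equiv (etriangleP T) _; exists f; split => //=.
  - by exists g.
  - by rewrite -compmA gf compm1.
by exists (ETriangle sT').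
Qed.

(** The given sequence is compared with an arbitrary realization of the
    pulled back class, whose middle term is isomorphic by [mid_iso]. *)
Lemma transport_cone A B D D' (T : etriangle s A B D) (f : hom D D')
    (g : hom D' D) : g ∘ f = idm D -> f ∘ g = idm D' ->
  exists T' : etriangle s A B D',
    [/\ infl T' = infl T, defl T' = f ∘ defl T & ext T' = pull E g (ext T)].
Proof.
move=> gf fg; have [[M x y] Me] := realizes_exists (pull E g (ext T)).
have e : push E (idm A) (ext T) = pull E f (pull E g (ext T)).
  by rewrite push1 -pull_comp gf pull1.
have [b /= [bx yb]] := realizes_mor e (etriangleP T) Me.
have b_iso : is_iso b.
  apply: (mid_iso (T := T) (T' := ETriangle Me) (a := idm A) (d := f)) => //.
  - exact: is_iso_idm.
  - by exists g.
have sT' : realizes s (pull E g (ext T)) (Seq (infl T) (f ∘ defl T)).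
  apply: realizes_equiv Me _; apply: seq_equiv_sym; exists b; split => //=.
  by rewrite bx compm1.
by exists (ETriangle sT').
Qed.

(** * Exactness of represented functors *)

(** Exactness at the middle term holds for every triangle. *)
Lemma exact_fromP X A B D (T : etriangle s A B D) :
  exact_from X T <->
  (forall u : hom X A, infl T ∘ u = 0 -> u = 0) /\
  (forall z : hom X D, exists v : hom X B, defl T ∘ v = z).
Proof.
split=> [[inj _ surj]|[inj surj]].
  by split=> // u xu; apply: inj; rewrite compm0.
split=> // [u v xuv|v].
  apply/eqP; rewrite -subr_eq0; apply/eqP/inj.
  rewrite compmDr compmN xuv; exact: subrr.
split=> [/factor_infl [t ->]|[u <-]]; first by exists t.
by rewrite compmA defl_infl comp0m.
Qed.

Lemma exact_toP X A B D (T : etriangle s A B D) :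
  exact_to X T <->
  (forall u : hom D X, u ∘ defl T = 0 -> u = 0) /\
  (forall z : hom A X, exists v : hom B X, v ∘ infl T = z).
Proof.
split=> [[inj _ surj]|[inj surj]].
  by split=> // u xu; apply: inj; rewrite comp0m.
split=> // [u v xuv|v].
  apply/eqP; rewrite -subr_eq0; apply/eqP/inj.
  rewrite compmDl compNm xuv; exact: subrr.
split=> [/factor_defl [t ->]|[u <-]]; first by exists t.
by rewrite -compmA defl_infl compm0.
Qed.

(** Triangles with the same class map to each other in both directions, which
    is enough to transfer exactness. *)
Lemma exact_from_ext X A B B' D (T : etriangle s A B D)
    (T' : etriangle s A B' D) :
  ext T' = ext T -> exact_from X T -> exact_from X T'.
Proof.
move=> e /exact_fromP [inj surj]; apply/exact_fromP.
have [|b /= [bx yb]] := realizes_mor (a := idm A) (d := idm D) _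
  (etriangleP T) (etriangleP T'); first by rewrite push1 pull1.
have [|b' /= [bx' yb']] := realizes_mor (a := idm A) (d := idm D) _
  (etriangleP T') (etriangleP T); first by rewrite push1 pull1.
split=> [u xu|z].
  by apply: inj; rewrite -(compm1 (infl T)) -bx' -compmA xu compm0.
by have [v <-] := surj z; exists (b ∘ v); rewrite compmA yb comp1m.
Qed.

Lemma exact_to_ext X A B B' D (T : etriangle s A B D)
    (T' : etriangle s A B' D) :
  ext T' = ext T -> exact_to X T -> exact_to X T'.
Proof.
move=> e /exact_toP [inj surj]; apply/exact_toP.
have [|b /= [bx yb]] := realizes_mor (a := idm A) (d := idm D) _
  (etriangleP T) (etriangleP T'); first by rewrite push1 pull1.
have [|b' /= [bx' yb']] := realizes_mor (a := idm A) (d := idm D) _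
  (etriangleP T') (etriangleP T); first by rewrite push1 pull1.
split=> [u uy|z].
  by apply: inj; rewrite -(comp1m (defl T)) -yb compmA uy comp0m.
by have [v <-] := surj z; exists (v ∘ b'); rewrite -compmA bx' compm1.
Qed.

(** * Homotopy pushouts *)

Lemma identity_triangle Z :
  exists T : etriangle s Z Z zob, infl T = idm Z /\ ext T = 0.
Proof.
have [|T [i _ e]] := transport_mid (f := pr1 Z zob) (splitT Z zob)
  _ (pr1_in1 _ _).
  apply: dsum_ext; rewrite ?compmA; first by rewrite pr1_in1 comp1m compm1.
  by rewrite [LHS]zob_final [RHS]zob_final.
by exists T; rewrite i e /= pr1_in1.
Qed.

Lemma sum_identity_triangle A B D (T : etriangle s A B D) Z :
  exists T' : etriangle s (A ⊕ Z) (B ⊕ Z) D,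
    [/\ infl T' = msum (infl T) (idm Z), defl T' = defl T ∘ pr1 B Z
      & ext T' = push E (in1 A Z) (ext T)].
Proof.
have [I [iI eI]] := identity_triangle Z.
have S := (extri_additive hs).2 _ _ _ _ _ _ _ _ _ _ _ _
  (etriangleP T) (etriangleP I).
have [|T' [i d e]] := transport_cone (f := pr1 D zob) (ETriangle S)
  _ (pr1_in1 _ _).
  apply: dsum_ext; rewrite ?compmA; first by rewrite pr1_in1 comp1m compm1.
  by rewrite [LHS]zob_final [RHS]zob_final.
exists T'; split.
- by rewrite i /= iI.
- by rewrite d /= /msum -!compmA !biprodE.
- rewrite e /= eI /ext_sum !raddf0 addr0 -push_pull -pull_comp.
  by rewrite pr1_in1 pull1.
Qed.

(** The split triangle on A (+) A' sheared by [a], so that its inflation is the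
    graph of [- a]. *)
Lemma graph_triangle A A' (a : hom A A') :
  exists T : etriangle s A (A ⊕ A') A',
    infl T = in1 A A' - in2 A A' ∘ a /\ defl T = a ∘ pr1 A A' + pr2 A A'.
Proof.
pose h := in2 A A' ∘ a ∘ pr1 A A'.
have hh : h ∘ h = 0 by rewrite /h -!compmA !biprodE.
have [||T [i d _]] := transport_mid (f := idm _ - h)
    (g := idm _ + h) (splitT A A').
- by rewrite !biprodE hh oppr0 addr0 subrK.
- by rewrite !biprodE hh subr0 addrK.
exists T; rewrite i d /= /h !biprodE -!compmA !biprodE.
by split; last exact: addrC.
Qed.

(** Apply (ET4) to the graph A -> A (+) A' -> A' and to the sum
    A (+) A' -> B (+) A' -> D of T with the identity triangle of A': the
    composite inflation is (x, -a), and the second triangle produced is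
    A' -> M -> D, with class [a_*]. *)
Lemma pushout A B D A' (T : etriangle s A B D) (a : hom A A') :
  exists (M : C) (T' : etriangle s A' M D) (b : hom B M)
      (S : etriangle s A (B ⊕ A') M),
    [/\ ext T' = push E a (ext T), b ∘ infl T = infl T' ∘ a,
        defl T' ∘ b = defl T,
        infl S = in1 B A' ∘ infl T - in2 B A' ∘ a
      & defl S = b ∘ pr1 B A' + infl T' ∘ pr2 B A'].
Proof.
have [G [iG dG]] := graph_triangle a.
have [P [iP dP eP]] := sum_identity_triangle T A'.
have [M [S [d [e [iS [dS [eS [de _]]]]]]]] := extri_ET4 hs G P.
have ed : push E (defl G) (ext P) = push E a (ext T).
  by rewrite dG eP -push_comp !biprodE -!compmA !biprodE.
rewrite ed in de.
have dS2 : defl S ∘ in2 B A' = d.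
  have := congr1 (fun f => f ∘ in2 A A') dS.
  by rewrite iP dG /msum -!compmA !biprodE -!compmA !biprodE.
have dSE : defl S = defl S ∘ in1 B A' ∘ pr1 B A' + d ∘ pr2 B A'.
  by rewrite -dS2 -!compmA -compmDr in_pr compm1.
have iSE : infl S = in1 B A' ∘ infl T - in2 B A' ∘ a.
  by rewrite iS iP iG /msum !biprodE -!compmA !biprodE.
exists M, (ETriangle de), (defl S ∘ in1 B A'), S; split=> //=.
- apply/eqP; rewrite -subr_eq0; apply/eqP.
  rewrite -(defl_infl S) {2}dSE iSE !biprodE -!compmA !biprodE.
  by rewrite -?compmA.
- by rewrite compmA eS dP -compmA pr1_in1 compm1.
Qed.

(** The pushout of T along [infl U] and that of U along [infl T] have the same
    middle term up to isomorphism, both being a cone of A -> B (+) G. *)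
Lemma bipushout A B D G F (T : etriangle s A B D) (U : etriangle s A G F) :
  exists (M : C) (P : etriangle s G M D) (Q : etriangle s B M F),
    [/\ ext P = push E (infl U) (ext T), ext Q = push E (infl T) (ext U),
        defl P ∘ infl Q = defl T, defl Q ∘ infl P = defl U
      & forall X (u : hom X B) (v : hom X G), infl Q ∘ u = infl P ∘ v ->
        exists t : hom X A, u = infl T ∘ t /\ v = infl U ∘ t].
Proof.
have [M [P [b [S [eP _ Pb iS dS]]]]] := pushout T (infl U).
have [N [Q [c [S' [eQ _ Qc iS' dS']]]]] := pushout U (infl T).
have swS : - swapm B G ∘ infl S = infl S' ∘ idm A.
  rewrite iS iS' /swapm !biprodE -!compmA !biprodE opprK.
  exact: addrC.
have [m [mS emS]] := extri_ET3 hs swS.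
have [n [nm mn]] : is_iso m.
  apply: cone_iso swS mS emS _ _; first exact: is_iso_idm.
  by exists (- swapm G B); rewrite !compNm !compmN !swapmK !opprK.
have mb : m ∘ b = - infl Q.
  have := congr1 (fun f => f ∘ in1 B G) mS.
  by rewrite /= dS dS' /swapm !biprodE -!compmA !biprodE.
have mP : m ∘ infl P = - c.
  have := congr1 (fun f => f ∘ in2 B G) mS.
  by rewrite /= dS dS' /swapm !biprodE -!compmA !biprodE.
have [||Q' [iQ dQ eQ']] := transport_mid (f := - n) (g := - m) Q.
- by rewrite !biprodE mn opprK.
- by rewrite !biprodE nm opprK.
have iQb : infl Q' = b.
  by rewrite iQ compNm -compmN -mb compmA nm comp1m.
exists M, P, Q'; split => //.
- by rewrite eQ'.
- by rewrite iQb.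
- by rewrite dQ compmN compNm -compmA mP compmN opprK.
move=> X u v; rewrite iQb => buv.
have [|t et] := factor_infl (T := S) (p := in1 B G ∘ u - in2 B G ∘ v).
  rewrite dS !biprodE -!compmA !biprodE buv; exact: subrr.
exists t; split.
- have := congr1 (fun f => pr1 B G ∘ f) et.
  by rewrite /= iS !biprodE -!compmA !biprodE.
- apply: oppr_inj; have := congr1 (fun f => pr2 B G ∘ f) et.
  by rewrite /= iS !biprodE -!compmA !biprodE.
Qed.

(** * Exactness of pushouts and composites *)

(** A morphism A -> A' -> X extends along A -> B, so the obstruction to
    extending A' -> X along A' -> M vanishes. *)
Lemma exact_to_cobase X A B D A' M (T : etriangle s A B D)
    (T' : etriangle s A' M D) (a : hom A A') (b : hom B M) :
  ext T' = push E a (ext T) -> defl T' ∘ b = defl T ->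
  exact_to X T -> exact_to X T'.
Proof.
move=> e Tb /exact_toP [inj surj]; apply/exact_toP; split=> [u uy|z].
  by apply: inj; rewrite -Tb compmA uy comp0m.
have [w wx] := surj (z ∘ a).
have [|v ->] := extend_infl (T := T') (u := z); last by exists v.
by rewrite e -push_comp -wx push_comp push_infl raddf0.
Qed.

(** There is no term to the left of C(X, A) in the long exact sequence, so a
    cobase change need not preserve injectivity of C(X, infl) on formal grounds;
    the weak pullback property supplies it. *)
Lemma exact_from_bipushout X A B D G F (T : etriangle s A B D)
    (U : etriangle s A G F) M (P : etriangle s G M D) (i : hom B M) :
  defl P ∘ i = defl T ->
  (forall (u : hom X B) (v : hom X G), i ∘ u = infl P ∘ v ->
     exists t : hom X A, u = infl T ∘ t /\ v = infl U ∘ t) ->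
  exact_from X T -> exact_from X P.
Proof.
move=> Pi pb /exact_fromP [inj surj]; apply/exact_fromP; split=> [v Pv|z].
  have [|t [Tt ->]] := pb 0 v; first by rewrite compm0 Pv.
  by rewrite (inj t) ?compm0.
by have [v <-] := surj z; exists (i ∘ v); rewrite compmA Pi.
Qed.

(** The octahedral diagram of (ET4). *)
Section Composite.
Variables (A B D G F : C) (T : etriangle s A B D) (T' : etriangle s B G F).
Variables (H : C) (T2 : etriangle s A G H) (T3 : etriangle s D H F).
Hypothesis iT2 : infl T2 = infl T' ∘ infl T.
Hypothesis dT2 : defl T2 ∘ infl T' = infl T3 ∘ defl T.
Hypothesis T3T2 : defl T3 ∘ defl T2 = defl T'.

Lemma composite_lift X (v : hom X H) :
  (forall z : hom X D, exists w, defl T ∘ w = z) ->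
  (forall z : hom X F, exists w, defl T' ∘ w = z) ->
  exists w, defl T2 ∘ w = v.
Proof.
move=> surj surj'; have [p Tp] := surj' (defl T3 ∘ v).
have [|t vt] := factor_infl (T := T3) (p := v - defl T2 ∘ p).
  by rewrite compmDr compmN compmA T3T2 Tp; exact: subrr.
have [w wt] := surj t; exists (p + infl T' ∘ w).
by rewrite compmDr compmA dT2 -compmA wt -vt addrC subrK.
Qed.

Lemma exact_from_composite X :
  exact_from X T -> exact_from X T' -> exact_from X T2 /\ exact_from X T3.
Proof.
move=> /exact_fromP [inj surj] /exact_fromP [inj' surj'].
split; apply/exact_fromP; split=> [u u0|z].
- by apply/inj/inj'; rewrite compmA -iT2.
- exact: composite_lift.
  (* Lift u : X -> D to B; the image in G dies in H, hence comes from A. *)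
- have [w wu] := surj u.
  have [|t wt] := factor_infl (T := T2) (p := infl T' ∘ w).
    by rewrite compmA dT2 -compmA wu.
  have -> : u = defl T ∘ (infl T ∘ t).
    rewrite -wu; congr (_ ∘ _); apply/eqP; rewrite -subr_eq0; apply/eqP/inj'.
    rewrite compmDr compmN wt iT2 compmA; exact: subrr.
  by rewrite compmA defl_infl comp0m.
- by have [v <-] := surj' z; exists (defl T2 ∘ v); rewrite compmA T3T2.
Qed.

Lemma exact_to_composite X :
  exact_to X T -> exact_to X T' -> exact_to X T2.
Proof.
move=> /exact_toP [inj surj] /exact_toP [inj' surj'].
apply/exact_toP; split=> [v v0|z].
  have [|t vt] := factor_defl (T := T3) (p := v).
    by apply: inj; rewrite -compmA -dT2 compmA v0 comp0m.
  by rewrite vt (inj' t) ?comp0m // -T3T2 compmA -vt.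
have [w <-] := surj z; have [v <-] := surj' w.
by exists v; rewrite iT2 compmA.
Qed.

End Composite.

(** * Proper classes *)

Section Proper.
Variable xi : etriangle_class s.
Hypotheses (hxi : proper_class xi) (hproj : enough_xi_projectives xi).

Lemma in_class_ext A B B' D (T : etriangle s A B D) (T' : etriangle s A B' D) :
  ext T' = ext T -> T ∈ xi -> T' ∈ xi.
Proof. by move=> e; apply: (proper_base hxi (d := idm D)); rewrite pull1. Qed.

(** Choose a triangle K -> P -> D in xi with P xi-projective: the class pulls
    back to 0 on P because P -> D lifts, and saturation applies. *)
Lemma in_class_projective A B D (T : etriangle s A B D) :
  (forall P (z : hom P D), xi_projective xi P -> exists w, defl T ∘ w = z) ->
  T ∈ xi.
Proof.
move=> surj; have [K [P [U [Uxi Pproj]]]] := hproj D.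
have [[M x y] Me] := realizes_exists (pull E (defl U) (ext T)).
apply: (proper_saturated hxi (T2 := U) (T := ETriangle Me)) => //.
apply: (proper_split hxi) => /=; have [w <-] := surj _ (defl U) Pproj.
by rewrite pull_comp pull_defl raddf0.
Qed.

(** Membership of the composite in xi comes from lifting morphisms from
    xi-projectives; the last triangle is a cobase change of T'. *)
Lemma composite A B D G F (T : etriangle s A B D) (T' : etriangle s B G F) :
  T ∈ xi -> T' ∈ xi ->
  exists (H : C) (T2 : etriangle s A G H) (T3 : etriangle s D H F),
    [/\ T2 ∈ xi, T3 ∈ xi,
        forall X, exact_from X T -> exact_from X T' ->
          exact_from X T2 /\ exact_from X T3,
        forall X, exact_to X T -> exact_to X T' -> exact_to X T2
      & forall X, exact_to X T' -> exact_to X T3].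
Proof.
move=> Txi T'xi.
have [H [T2 [d [e [iT2 [dT2 [eT2 [de _]]]]]]]] := extri_ET4 hs T T'.
pose T3 : etriangle s D H F := ETriangle de.
exists H, T2, T3; split.
- apply: in_class_projective => P z Pproj.
  have /exact_fromP [_ surj] := Pproj _ _ _ _ Txi.
  have /exact_fromP [_ surj'] := Pproj _ _ _ _ T'xi.
  exact: (composite_lift (T := T) (T' := T') (T3 := T3)).
- exact: (proper_cobase hxi (T := T') (a := defl T)).
- by move=> X; apply: exact_from_composite.
- by move=> X; apply: (exact_to_composite (T3 := T3)).
- move=> X; exact: (exact_to_cobase (T' := T3) erefl eT2).
Qed.

(** * The horseshoe lemma *)

Section Horseshoe.
Variables W V : C -> Prop.

(** Keeping the class V of covariant test objects independent of W lets the
    same construction serve with V empty and with V equal to W. *)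
Definition coproper A B D (T : etriangle s A B D) : Prop :=
  [/\ T ∈ xi, T ∈ contra_exact W & T ∈ cov_exact V].

Lemma coproper_composite A B D G F (T : etriangle s A B D)
    (T' : etriangle s B G F) :
  T ∈ xi -> T ∈ cov_exact V -> coproper T' ->
  exists (H : C) (T2 : etriangle s A G H) (T3 : etriangle s D H F),
    [/\ T2 ∈ xi, coproper T3 & T ∈ contra_exact W -> coproper T2].
Proof.
move=> Txi TV [T'xi T'W T'V].
have [H [T2 [T3 [T2xi T3xi fromX toX to3]]]] := composite Txi T'xi.
exists H, T2, T3; split=> //; first split=> // X XX.
- exact: to3 (T'W X XX).
- by have [] := fromX X (TV X XX) (T'V X XX).
- move=> TW; split=> // X XX; first exact: toX (TW X XX) (T'W X XX).
  by have [] := fromX X (TV X XX) (T'V X XX).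
Qed.

Lemma coproper_bipushout A B D G F (T : etriangle s A B D)
    (U : etriangle s A G F) :
  T ∈ xi -> T ∈ cov_exact V -> coproper U ->
  exists (M : C) (P : etriangle s G M D) (Q : etriangle s B M F),
    [/\ P ∈ xi, P ∈ cov_exact V, coproper Q
      & ext P = push E (infl U) (ext T)].
Proof.
move=> Txi TV [Uxi UW UV].
have [M [P [Q [eP eQ PQ QP pb]]]] := bipushout T U.
exists M, P, Q; split=> //.
- exact: (proper_cobase hxi) eP Txi.
- move=> X XV; apply: exact_from_bipushout PQ _ (TV X XV); exact: pb.
split.
- exact: (proper_cobase hxi) eQ Uxi.
- move=> X XW; exact: exact_to_cobase eQ QP (UW X XW).
- move=> X XV; apply: (exact_from_bipushout (U := T)) QP _ (UV X XV).
  by move=> u v e; have [t [? ?]] := pb _ v u (esym e); exists t.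
Qed.

(** The summands of the middle term are exchanged to fit the order of the terms
    of the coresolution in [horseshoe]. *)
Lemma coproper_sum_identity A B D Z (T : etriangle s A B D) :
  coproper T ->
  exists T' : etriangle s (A ⊕ Z) (Z ⊕ B) D, coproper T'.
Proof.
move=> [Txi TW TV].
have [T1 [iT1 dT1 eT1]] := sum_identity_triangle T Z.
have [T' [_ _ eT']] := transport_mid T1 (swapmK _ _) (swapmK _ _).
exists T'; split.
- apply: in_class_ext eT' _; exact: (proper_cobase hxi) eT1 Txi.
- move=> X XW; apply: exact_to_ext eT' _.
  have dT1b : defl T1 ∘ in1 B Z = defl T.
    by rewrite dT1 -compmA pr1_in1 compm1.
  exact: exact_to_cobase eT1 dT1b (TW X XW).
- move=> X XV; apply: exact_from_ext eT' _.
  have /exact_fromP [inj surj] := TV X XV; apply/exact_fromP.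
  split=> [u|z].
    rewrite iT1 /msum => u0; apply: dsum_ext; rewrite compm0.
      apply: inj; have := congr1 (fun f => pr1 B Z ∘ f) u0.
      by rewrite /= !biprodE -!compmA !biprodE.
    have := congr1 (fun f => pr2 B Z ∘ f) u0.
    by rewrite /= !biprodE -!compmA !biprodE.
  have [v <-] := surj z; exists (in1 B Z ∘ v).
  by rewrite dT1 -compmA pr1_in1K.
Qed.

(** WA lies in W, so A -> WA extends to B and the cobase change
    WA -> M -> D of T splits.  Then B -> D (+) WA is composed with
    D (+) WA -> WA (+) WD. *)
Lemma horseshoe A B D WA A' WD D' (T : etriangle s A B D)
    (TA : etriangle s A WA A') (TD : etriangle s D WD D') :
  W WA -> coproper T -> coproper TA -> coproper TD ->
  exists (B' : C) (TB : etriangle s B (WA ⊕ WD) B') (T' : etriangle s A' B' D'),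
    coproper TB /\ coproper T'.
Proof.
move=> WWA [Txi TW TV] TAc TDc.
have [M [P [Q [_ _ [Qxi QW QV] eP]]]] := coproper_bipushout Txi TV TAc.
have P0 : ext P = 0.
  have /exact_toP [_ surj] := TW WA WWA; have [p px] := surj (infl TA).
  by rewrite eP -px push_comp push_infl raddf0.
have [f [[g [gf fg]] _ _]] : seq_equiv (Seq (infl P) (defl P))
    (Seq (in1 WA D) (pr2 WA D)).
  apply: (realizes_uniq (e := 0)); first by rewrite -P0; exact: etriangleP.
  exact: etriangleP (splitT WA D).
have [||Q' [_ _ eQ]] := transport_mid (f := swapm WA D ∘ f)
  (g := g ∘ swapm D WA) Q.
- by rewrite -compmA (compmA (swapm D WA)) swapmK comp1m.
- by rewrite -compmA (compmA f) fg comp1m swapmK.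
have Q'xi : Q' ∈ xi by apply: in_class_ext eQ Qxi.
have Q'V : Q' ∈ cov_exact V by move=> X XV; apply: exact_from_ext eQ (QV X XV).
have Q'W : Q' ∈ contra_exact W by move=> X XW; apply: exact_to_ext eQ (QW X XW).
have [TI TIc] := coproper_sum_identity WA TDc.
have [B' [TB [T' [_ T'c TBc]]]] := coproper_composite Q'xi Q'V TIc.
by exists B', TB, T'; split=> //; apply: TBc.
Qed.

(** Iterate [horseshoe].  The state after i steps is a coproper triangle
    linking the i-th cosyzygies of A and D; its middle term is the i-th cosyzygy
    of B. *)
Lemma horseshoe_coresolution A B D (T : etriangle s A B D)
    (WA LA WD LD : nat -> C)
    (TA : forall i, etriangle s (cosyzygy A LA i) (WA i) (LA i))
    (TD : forall i, etriangle s (cosyzygy D LD i) (WD i) (LD i)) :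
  (forall i, W (WA i)) -> coproper T ->
  (forall i, coproper (TA i)) -> (forall i, coproper (TD i)) ->
  exists (L : nat -> C)
    (TB : forall i, etriangle s (cosyzygy B L i) (WA i ⊕ WD i) (L i)),
    forall i, coproper (TB i).
Proof.
move=> WWA Tc TAc TDc.
pose state i := {K : C & {U : etriangle s (cosyzygy A LA i) K (cosyzygy D LD i)
                         | coproper U}}.
pose next i (x : state i) (y : state i.+1) :=
  exists U : etriangle s (projT1 x) (WA i ⊕ WD i) (projT1 y), coproper U.
have step i (x : state i) : {y : state i.+1 | next i x y}.
  apply: constructive_indefinite_description; case: x => K [U Uc].
  have [K' [V' [U' [V'c U'c]]]] := horseshoe (WWA i) Uc (TAc i) (TDc i).
  by exists (existT _ K' (exist _ U' U'c)), V'.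
pose st := fix st i : state i :=
  if i is j.+1 then sval (step j (st j)) else existT _ B (exist _ T Tc).
have TBex i : {U : etriangle s (projT1 (st i)) (WA i ⊕ WD i)
                     (projT1 (st i.+1)) | coproper U}.
  apply: constructive_indefinite_description.
  exact: proj2_sig (step i (st i)).
pose L i := projT1 (st i.+1).
(* The case analysis on i makes the types convertible. *)
pose TB i : etriangle s (cosyzygy B L i) (WA i ⊕ WD i) (L i) :=
  match i with 0 => sval (TBex 0) | j.+1 => sval (TBex j.+1) end.
exists L, TB => -[|i].
  exact (proj2_sig (TBex 0)).
exact (proj2_sig (TBex i.+1)).
Qed.

End Horseshoe.
End Proper.

(** * Decompositions of a complex into triangles *)

Lemma exact_from_iso X A B D A' D' (T : etriangle s A B D)
    (T' : etriangle s A' B D') (a : hom A A') (d : hom D D') :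
  is_iso a -> is_iso d -> infl T = infl T' ∘ a -> d ∘ defl T = defl T' ->
  exact_from X T' -> exact_from X T.
Proof.
move=> [a' [a'a _]] [d' [d'd _]] Ta Td /exact_fromP [inj surj].
apply/exact_fromP; split=> [u u0|z].
  have au : a ∘ u = 0 by apply: inj; rewrite compmA -Ta.
  by rewrite -(comp1m u) -a'a -compmA au compm0.
have [v Tv] := surj (d ∘ z); exists v.
by rewrite -(comp1m z) -d'd -compmA -Tv -Td !compmA d'd comp1m.
Qed.

(** Two decompositions of one complex are isomorphic when the first is
    C(-, V)-exact.  Each cosyzygy is a cone of the previous inflation; since
    precomposition with [defl (T i)] is injective on morphisms to V^(i+1), the
    equality of the differentials passes to the next inflations. *)
Lemma exact_from_decomposition X A (V L L' : nat -> C)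
    (T : forall i, etriangle s (cosyzygy A L i) (V i) (L i))
    (T' : forall i, etriangle s (cosyzygy A L' i) (V i) (L' i)) :
  infl (T 0) = infl (T' 0) ->
  (forall i, infl (T i.+1) ∘ defl (T i) = infl (T' i.+1) ∘ defl (T' i)) ->
  (forall i, exact_to (V i.+1) (T i)) ->
  (forall i, exact_from X (T' i)) -> forall i, exact_from X (T i).
Proof.
move=> e0 eS Tto T'from.
have cone i (a : hom (cosyzygy A L i) (cosyzygy A L' i)) :
    is_iso a -> infl (T i) = infl (T' i) ∘ a ->
    exists d : hom (L i) (L' i), is_iso d /\ d ∘ defl (T i) = defl (T' i).
  move=> a_iso Ta; have [|d [/= dT e]] := extri_ET3 hs (T := T i) (T' := T' i)
    (a := a) (b := idm _); first by rewrite comp1m.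
  exists d; split; last by rewrite dT compm1.
  apply: cone_iso _ dT e a_iso _; first by rewrite comp1m.
  exact: is_iso_idm.
have syz i : exists a : hom (cosyzygy A L i) (cosyzygy A L' i),
    is_iso a /\ infl (T i) = infl (T' i) ∘ a.
  elim: i => [|i [a [a_iso Ta]]].
    by exists (idm A); split; [exact: is_iso_idm | rewrite compm1].
  have [d [d_iso dT]] := cone _ _ a_iso Ta; exists d; split=> //.
  have [inj _ _] := Tto i; apply: inj.
  by rewrite eS -dT compmA.
move=> i; have [a [a_iso Ta]] := syz i.
have [d [d_iso dT]] := cone _ _ a_iso Ta.
exact: exact_from_iso a_iso d_iso Ta dT (T'from i).
Qed.

Lemma splice_triangles A (V L : nat -> C)
    (T : forall i, etriangle s (cosyzygy A L i) (V i) (L i)) :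
  exists R : cocomplex A V, aug R = infl (T 0) /\
    forall i, diff R i = infl (T i.+1) ∘ defl (T i).
Proof.
have diff_aug : infl (T 1) ∘ defl (T 0) ∘ infl (T 0) = 0.
  by rewrite -compmA defl_infl compm0.
have diff_diff i :
    (infl (T i.+2) ∘ defl (T i.+1)) ∘ (infl (T i.+1) ∘ defl (T i)) = 0.
  by rewrite -compmA (compmA (defl _)) defl_infl comp0m compm0.
by exists (Cocomplex diff_aug diff_diff).
Qed.

End Extriangulated.

Theorem theorem3p7 (C : additiveCategory) (E : extBifunctor C)
    (s : realization E) (hs : extriangulated s)
    (xi : etriangle_class s) (hxi : proper_class xi)
    (hproj : enough_xi_projectives xi) (hinj : enough_xi_injectives xi)
    (hWIC : WIC s)
    (WW : C -> Prop) (hsum : closed_dsum WW) (hcok : closed_hocokernel xi WW)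
    (Y1 Y0 Y : C) (T : etriangle s Y1 Y0 Y) (hT : T ∈ xi)
    (W0 W1 : nat -> C) (R0 : cocomplex Y0 W0) (R1 : cocomplex Y1 W1)
    (hR0 : coproper_coresolution xi WW R0)
    (hR1 : coproper_coresolution xi WW R1) :
  exists (W : C) (R : cocomplex Y (cone_terms W0 W1 W))
      (T' : etriangle s (W1 0%N) (W0 0%N ⊕ W1 1%N) W),
    [/\ WW W, coproper_coresolution xi WW R & T' ∈ xi] /\
    (xi_exact_by xi (cov_exact WW) R0 ->
     xi_exact_by xi (cov_exact WW) R1 ->
     T ∈ cov_exact WW ->
     xi_exact_by xi (cov_exact WW) R).
Proof.
have [[_ WW0] [L0 [T0 [T0xi T0W aug0 diff0]]]] := hR0.
have [[_ WW1] [L1 [T1 [T1xi T1W aug1 diff1]]]] := hR1.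
pose cov := [/\ xi_exact_by xi (cov_exact WW) R0,
  xi_exact_by xi (cov_exact WW) R1 & T ∈ cov_exact WW].
(* With this test class, V-exactness is vacuous unless the hypotheses of the
   second part hold. *)
pose V (X : C) := cov /\ WW X.
have T0c i : coproper xi WW V (T0 i).
  split=> // X [[[L' [T' [_ T'cov aug' diff']]] _ _] XW].
  apply: (exact_from_decomposition hs (T' := T')) => // [|j|j|j].
  - by rewrite -aug0.
  - by rewrite -diff0.
  - exact/T0W.
  - exact: T'cov.
have T1c i : coproper xi WW V (T1 i).
  split=> // X [[_ [L' [T' [_ T'cov aug' diff']]] _] XW].
  apply: (exact_from_decomposition hs (T' := T')) => // [|j|j|j].
  - by rewrite -aug1.
  - by rewrite -diff1.
  - exact/T1W.
  - exact: T'cov.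
have TV : T ∈ cov_exact V by move=> X [[_ _ Tcov]]; exact: Tcov.
have [M [P [Q [Pxi PV Qc _]]]] := coproper_bipushout hs hxi hT TV (T1c 0).
(* The coresolution of the first cosyzygy L1 0 of Y1. *)
pose T1' i : etriangle s (cosyzygy (L1 0) (fun j => L1 j.+1) i) (W1 i.+1)
    (L1 i.+1) := match i with 0 => T1 1 | j.+1 => T1 j.+2 end.
have T1'c i : coproper xi WW V (T1' i).
  by case: i => [|i]; [exact (T1c 1) | exact (T1c i.+2)].
have [L [TB TBc]] := horseshoe_coresolution hs hxi hproj WW0 Qc T0c T1'c.
have [W [T2 [T3 [T2xi T3c _]]]] :=
  coproper_composite hs hxi hproj Pxi PV (TBc 0).
have WWW : WW W.
  by apply: (hcok _ _ _ _ T2xi (WW1 0)); apply: hsum.2.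
pose TR i : etriangle s (cosyzygy Y L i) (cone_terms W0 W1 W i) (L i) :=
  match i with 0 => T3 | j.+1 => TB j.+1 end.
have TRc i : coproper xi WW V (TR i).
  by case: i => [|i]; [exact: T3c | exact (TBc i.+1)].
have [R [augR diffR]] := splice_triangles hs TR.
exists W, R, T2; split; first split=> //.
- split; first split.
  + by exists L, TR; split=> // i; have [] := TRc i.
  + by case=> [|i] //=; apply: hsum.2.
  + by exists L, TR; split=> // i; have [] := TRc i.
- move=> R0cov R1cov Tcov; exists L, TR; split=> // i.
    by have [] := TRc i.
  have [_ _ TRV] := TRc i.
  by move=> X XW; apply: TRV.
Qed.
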